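(* Let $\Sigma$ be a finite alphabet with at least two symbols. There is no algorithm with oracle access which, for every eventually strongly almost periodic sequence $\omega\in\Sigma^{\mathbb{N}}$ and every almost periodicity regulator $f$ of $\omega$, given oracle access to $\omega$ and $f$, halts and outputs a natural number $l\ge\mathrm{pr}(\omega)$.
   Context: For a sequence $\omega$, write $\omega[i,j]=\omega(i)\dots\omega(j)$ and $\omega[i,\infty)$ for the suffix starting at $i$; a factor is a nonempty string $\omega[i,j]$. A sequence is strongly almost periodic (SAP) if for every factor $x$ there is $l$ such that every factor of length $l$ contains an occurrence of $x$; it is eventually strongly almost periodic if some suffix is SAP, and $\mathrm{pr}(\omega)$ is the least $m$ with $\omega[m,\infty)$ SAP. A function $r\colon\mathbb{N}\to\mathbb{N}$ is an almost periodicity regulator of $\omega$ if (1) every string of length $k$ occurring in $\omega$ infinitely many times occurs in every factor of $\omega$ of length $r(k)$, and (2) every string of length $k$ occurring in $\omega$ only finitely many times does not occur in $\omega[r(k),\infty)$. An algorithm with oracle access to $\omega$ and $f$ may query values $\omega(i)$ and $f(i)$ (equivalently, it reads a binary sequence encoding the pair $\langle\omega,f\rangle$). *)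

(* Defs.v *)
From mathcomp Require Import all_boot.
From mathcomp Require Import boolp classical_sets cardinality.

Set Implicit Arguments.
Unset Strict Implicit.
Unset Printing Implicit Defensive.

Local Open Scope classical_set_scope.

Section Sequences.
Variable Sigma : finType.
Implicit Types (omega : nat -> Sigma) (x : seq Sigma).

(* The string omega[i, i + n - 1] of length n.  The factors of omega are the
   strings [block omega i n] with 0 < n. *)
Definition block omega (i n : nat) : seq Sigma :=
  mkseq (fun k => omega (i + k)) n.

Definition shift (m : nat) omega : nat -> Sigma := fun k => omega (m + k).

Definition occurrences omega x : set nat :=
  [set i | block omega i (size x) = x].

(* A window of length l = 0 is the empty string, in which no factor occurs, so
   the length l below is necessarily positive. *)
Definition strongly_almost_periodic omega : Prop :=
  forall i n, 0 < n ->
  exists l, forall j, infix (block omega i n) (block omega j l).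

Definition eventually_sap omega : Prop :=
  exists m, strongly_almost_periodic (shift m omega).

Lemma eventually_sapb omega : eventually_sap omega ->
  exists m, `[< strongly_almost_periodic (shift m omega) >].
Proof. by case=> m sap_m; exists m; apply/asboolP. Qed.

Definition pr omega (esap : eventually_sap omega) : nat :=
  ex_minn (eventually_sapb esap).

(* As above, r k = 0 is excluded by the first clause when 0 < k: some string of
   length k occurs infinitely many times. *)
Definition regulator omega (r : nat -> nat) : Prop :=
  forall x,
    (infinite_set (occurrences omega x) ->
       forall j, infix x (block omega j (r (size x)))) /\
    (finite_set (occurrences omega x) ->
       occurrences (shift (r (size x)) omega) x = set0).

End Sequences.

(* Partial recursive functions relative to two oracles, by arity: the basic
   functions and the two oracle queries, closed under composition, primitive
   recursion and unbounded minimisation. *)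
Inductive program : nat -> Type :=
| Zero n : program n
| Succ : program 1
| Proj n of 'I_n : program n
| QuerySeq : program 1
| QueryReg : program 1
| Comp k n of program k & ('I_k -> program n) : program n
| PrimRec n of program n & program n.+2 : program n.+1
| Mu n of program n.+1 : program n.

Section Semantics.
Variables (Sigma : finType) (omega : nat -> Sigma) (f : nat -> nat).

(* [computes p v y]: with oracles omega and f, the program p halts on input v
   with output y.  A symbol is returned by the oracle as its rank in the
   enumeration of Sigma, a number below #|Sigma|. *)
Fixpoint computes n (p : program n) : n.-tuple nat -> nat -> Prop :=
  match p in program n return n.-tuple nat -> nat -> Prop with
  | Zero _ => fun _ y => y = 0
  | Succ => fun v y => y = (thead v).+1
  | Proj _ i => fun v y => y = tnth v i
  | QuerySeq => fun v y => y = enum_rank (omega (thead v))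
  | QueryReg => fun v y => y = f (thead v)
  | Comp k _ g h => fun v y => exists w : k.-tuple nat,
      (forall i, computes (h i) v (tnth w i)) /\ computes g w y
  | PrimRec _ b s => fun v =>
      (fix rec (m : nat) : nat -> Prop :=
         match m with
         | 0 => fun y => computes b [tuple of behead v] y
         | m'.+1 => fun y => exists z, rec m' z /\
             computes s [tuple of m' :: z :: behead v] y
         end) (thead v)
  | Mu _ q => fun v y => computes q [tuple of y :: v] 0 /\
      forall z, z < y -> exists u, computes q [tuple of z :: v] u.+1
  end.

End Semantics.

(* Main.v *)
Require Import Defs.
From mathcomp Require Import all_boot.
From mathcomp Require Import boolp classical_sets cardinality.
From mathcomp Require Import zify.

(** A halting run queries only finitely many values, so it suffices to find a
    strongly almost periodic [omega] with a regulator [f] such that, for all [N]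
    and [l], some [omega'] and [f'] agree with [omega] and [f] below [N] while
    [l < pr omega'].  Let the symbol [omega n] be given by the parity of the
    2-adic valuation of [n + 1], and [f k = 2 ^ (k + 3)].  Capping the valuation
    at [N + 1] beyond a large position [M] makes the sequence [omega']
    eventually periodic of period [2 ^ (N + 1)].  Words of length at most
    [2 ^ N] meet at most one position of valuation at least [N]; whatever the
    parity there, it is already realised by positions of valuation exactly [N]
    or [N + 1], so these words do not see the change.  On the other hand a
    strongly almost periodic suffix of [omega'] would be periodic, which fails
    just before [M]. *)

Set Implicit Arguments.
Unset Strict Implicit.
Unset Printing Implicit Defensive.

(** * Halting runs depend on finitely many oracle values *)

Section OracleUse.
Variable Sigma : finType.
Implicit Types (omega : nat -> Sigma) (f : nat -> nat).

Lemma computes_inj omega f n (p : program n) v y z :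
  computes omega f p v y -> computes omega f p v z -> y = z.
Proof.
elim: n / p v y z => [n||n i|||k n g IHg h IHh|n b IHb s IHs|n q IHq] v y z /=;
  try by move=> -> ->.
- move=> [w [hw gw]] [w' [hw' gw']].
  have ww' : w = w' by apply: eq_from_tnth => i; apply: IHh (hw i) (hw' i).
  by rewrite -ww' in gw'; apply: IHg gw gw'.
- elim: (thead v) y z => [|m IHm] y z /=; first exact: IHb.
  move=> [u [mu su]] [u' [mu' su']].
  by rewrite -(IHm _ _ mu mu') in su'; apply: IHs su su'.
- move=> [qy lty] [qz ltz]; case: (ltngtP y z) => [/ltz[u qu]|/lty[u qu]|//].
    by have := IHq _ _ _ qy qu.
  by have := IHq _ _ _ qz qu.
Qed.

Definition agree_below N omega f omega' f' :=
  forall i, i < N -> omega' i = omega i /\ f' i = f i.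

Lemma agree_belowW M N omega f omega' f' : M <= N ->
  agree_below N omega f omega' f' -> agree_below M omega f omega' f'.
Proof. by move=> leMN agr i ltiM; apply: agr; apply: leq_trans leMN. Qed.

(** Says that [P] holds on a neighbourhood of the pair [(omega, f)] in the product topology. *)
Definition has_finite_use omega f (P : (nat -> Sigma) -> (nat -> nat) -> Prop) :=
  exists N, forall omega' f', agree_below N omega f omega' f' -> P omega' f'.

Lemma has_finite_useI omega f P Q :
  has_finite_use omega f P -> has_finite_use omega f Q ->
  has_finite_use omega f (fun omega' f' => P omega' f' /\ Q omega' f').
Proof.
move=> [M PM] [N QN]; exists (maxn M N) => omega' f' agr.
by split; [apply: PM|apply: QN]; apply: agree_belowW agr;
  rewrite ?leq_maxl ?leq_maxr.
Qed.

Lemma has_finite_use_forall omega f n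
    (P : 'I_n -> (nat -> Sigma) -> (nat -> nat) -> Prop) :
  (forall i, has_finite_use omega f (P i)) ->
  has_finite_use omega f (fun omega' f' => forall i, P i omega' f').
Proof.
move=> /choice[N PN]; exists (\max_i N i) => omega' f' agr i.
by apply: PN; apply: agree_belowW agr; apply: leq_bigmax.
Qed.

Lemma has_finite_useW omega f (P Q : (nat -> Sigma) -> (nat -> nat) -> Prop) :
  (forall omega' f', P omega' f' -> Q omega' f') ->
  has_finite_use omega f P -> has_finite_use omega f Q.
Proof. by move=> PQ [N PN]; exists N => omega' f' /PN /PQ. Qed.

Lemma computes_finite_use omega f n (p : program n) v y :
  computes omega f p v y ->
  has_finite_use omega f (fun omega' f' => computes omega' f' p v y).
Proof.
elim: n / p v y => [n||n i|||k n g IHg h IHh|n b IHb s IHs|n q IHq] v y /=;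
  try by move=> ->; exists 0.
- by move=> ->; exists (thead v).+1 => omega' f' /(_ _ (ltnSn _)) [-> _].
- by move=> ->; exists (thead v).+1 => omega' f' /(_ _ (ltnSn _)) [_ ->].
- move=> [w [hw gw]].
  have hw' := has_finite_use_forall (fun i => IHh i _ _ (hw i)).
  apply: has_finite_useW (has_finite_useI hw' (IHg _ _ gw)) => omega' f' ?.
  by exists w.
- elim: (thead v) y => [|m IHm] y /=; first exact: IHb.
  move=> [u [mu su]].
  apply: has_finite_useW (has_finite_useI (IHm _ mu) (IHs _ _ su)) => *.
  by exists u.
- move=> [qy lty].
  (* The bounded quantifier over [z < y] becomes one over ['I_y], so that the uses of the finitely
     many tests have a maximum. *)
  have lty' : forall i : 'I_y, has_finite_use omega f (fun omega' f' =>
      exists u, computes omega' f' q [tuple of val i :: v] u.+1).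
    move=> i; have [u qu] := lty i (ltn_ord i).
    by apply: has_finite_useW (IHq _ _ qu) => *; exists u.
  apply: has_finite_useW
    (has_finite_useI (IHq _ _ qy) (has_finite_use_forall lty')).
  move=> omega' f' [qy' ltz]; split=> // z ltzy.
  exact: ltz (Ordinal ltzy).
Qed.

End OracleUse.

(** * Recurrence of words and eventual periodicity *)

Section Words.
Variable Sigma : finType.
Implicit Types (x : nat -> Sigma) (w : seq Sigma).

Lemma eq_block x i j n :
  (forall t, t < n -> x (i + t) = x (j + t)) -> block x i n = block x j n.
Proof.
move=> eqx; apply/eq_in_map => t; rewrite mem_iota add0n => /andP[_].
exact: eqx.
Qed.

Lemma block_cat x i m n : block x i (m + n) = block x i m ++ block x (i + m) n.
Proof.
rewrite /block /mkseq iotaD map_cat add0n -{2}(addn0 m) iotaDl -map_comp.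
by congr (_ ++ _); apply: eq_map => t /=; rewrite addnA.
Qed.

Lemma infix_block x i n j l :
  j <= i -> i + n <= j + l -> infix (block x i n) (block x j l).
Proof.
move=> leji le_end; apply/infixP.
have {le_end} [e ->] : exists e, l = (i - j) + (n + e).
  by exists (j + l - (i + n)); lia.
exists (block x j (i - j)), (block x (i + n) e).
by rewrite !block_cat subnKC.
Qed.

Lemma infix_blockP x w j l : infix w (block x j l) ->
  exists2 i, j <= i & block x i (size w) = w.
Proof.
move=> /infixP[s [s' eqs]]; exists (j + size s); first exact: leq_addr.
have eql : l = size s + (size w + size s').
  by rewrite -!size_cat -eqs size_mkseq.
move: eqs; rewrite eql !block_cat => /eqP.
rewrite eqseq_cat ?size_mkseq // => /andP[_].
by rewrite eqseq_cat ?size_mkseq // => /andP[/eqP].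
Qed.

Lemma block_shift m x i n : block (shift m x) i n = block x (m + i) n.
Proof. by apply: eq_map => t; rewrite /shift addnA. Qed.

Lemma nth_block a x i n t : t < n -> nth a (block x i n) t = x (i + t).
Proof. exact: nth_mkseq. Qed.

Lemma finite_set_nat_bounded (A : set nat) :
  finite_set A -> exists B, forall i, A i -> i < B.
Proof.
move=> /finite_seqP[s ->]; exists (\max_(i <- s) i).+1 => i /= si.
by rewrite ltnS; apply: leq_bigmax_seq.
Qed.

(* Both clauses of a regulator, at a single length: the hypothesis makes every
   word occurring at or after [m] occur in every window of length [r]. *)
Lemma regulator_at x m k r :
  m <= r ->
  (forall i j, m <= i ->
     exists i', [/\ j <= i', i' + k <= j + r & block x i' k = block x i k]) ->
  forall w, size w = k ->
    (infinite_set (occurrences x w) -> forall j, infix w (block x j r)) /\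
    (finite_set (occurrences x w) -> occurrences (shift r x) w = set0).
Proof.
move=> le_mr rec w szw; split=> [inf j|/finite_set_nat_bounded[B ltB]].
  have [i [lemi occ]] : exists i, m <= i /\ block x i k = w.
    apply: contrapT => /forallNP nocc.
    apply: inf; apply: (@sub_finite_set _ _ `I_m); last exact: finite_II.
    move=> i occi /=; rewrite ltnNge; apply/negP => lemi.
    by apply: (nocc i); rewrite -szw.
  have [i' [leji' le_end eqw]] := rec i j lemi.
  by rewrite -occ -eqw; apply: infix_block.
(* An occurrence at or after [r] would recur at or after [B], which bounds all occurrences. *)
rewrite -subset0 => i; rewrite /occurrences /= block_shift szw => occ.
have [i' [leBi' _ eqw]] := rec _ B (leq_trans le_mr (leq_addr i r)).
have /ltB : occurrences x w i' by rewrite /occurrences /= szw eqw.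
by rewrite ltnNge leBi'.
Qed.

Lemma periodic_mul x m p : (forall n, m <= n -> x (n + p) = x n) ->
  forall c n, m <= n -> x (n + c * p) = x n.
Proof.
move=> per; elim=> [|c IHc] n lemn; first by rewrite mul0n addn0.
by rewrite mulSn addnA IHc ?per // (leq_trans lemn) ?leq_addr.
Qed.

Lemma periodic_recurrence x m p : 0 < p ->
  (forall n, m <= n -> x (n + p) = x n) ->
  forall k i j, m <= i -> exists i',
    [/\ j <= i', i' + k <= j + (m + p + k) & block x i' k = block x i k].
Proof.
move=> p_gt0 per k i j lemi.
have := divn_eq (i - m) p; have := ltn_pmod (i - m) p_gt0.
set q := _ %/ p; set r := _ %% p => ltrp eqi.
(* Here [q'] rounds [(j - r) / p] up, so [m + r + q' * p] is the first position from [m + j] on that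
   is congruent to [i] modulo [p]. *)
have := divn_eq (j + p.-1 - r) p; have := ltn_pmod (j + p.-1 - r) p_gt0.
set q' := _ %/ p; set r' := _ %% p => ltr'p eqj.
exists (m + r + q' * p); split; try by lia.
apply: eq_block => t _.
have -> : i + t = m + r + t + q * p by lia.
have -> : m + r + q' * p + t = m + r + t + q' * p by lia.
by rewrite !(periodic_mul per) //; lia.
Qed.

Lemma sap_periodic x m p : 0 < p ->
  (forall n, m <= n -> x (n + p) = x n) -> strongly_almost_periodic (shift m x).
Proof.
move=> p_gt0 per i n _; exists (m + p + n) => j.
have [i' [leji' le_end eqw]] :=
  periodic_recurrence p_gt0 per n (m + j) (leq_addr i m).
by rewrite !block_shift -eqw; apply: infix_block.
Qed.

(** The word of length [p + 1] at [n] recurs beyond [m], where its first and last letters agree;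
    hence they agree at [n] as well. *)
Lemma sap_suffix_periodic x m k p : (forall n, m <= n -> x (n + p) = x n) ->
  strongly_almost_periodic (shift k x) ->
  forall n, k <= n -> x (n + p) = x n.
Proof.
move=> per sap n lekn.
have [l /(_ m)] := sap (n - k) p.+1 (ltn0Sn _).
rewrite !block_shift subnKC // => /infix_blockP[i le_i].
rewrite size_mkseq => eqw.
rewrite -[in RHS](addn0 n) -!(nth_block (x 0) x n (n:=p.+1)) // -eqw.
by rewrite !nth_block // addn0 per //; apply: leq_trans (leq_addl _ _) le_i.
Qed.

End Words.

(** * Recurrence of 2-adic valuations *)

(** The capped valuation of a positive number is the valuation of its gcd with [2 ^ N], which
    ignores multiples of [2 ^ N]. *)
Lemma minn_logn_mulD N c d : 0 < d ->
  minn (logn 2 (c * 2 ^ N + d)) N = minn (logn 2 d) N.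
Proof.
move=> d_gt0; rewrite -{2 3}(pfactorK N (isT : prime 2)).
by rewrite -!logn_gcd ?expn_gt0 ?addn_gt0 ?d_gt0 ?orbT // !(gcdnC _ (2 ^ N)) gcdnMDl.
Qed.

Lemma logn_lt_mulD N c d : 0 < d < 2 ^ N ->
  logn 2 (c * 2 ^ N + d) = logn 2 d /\ logn 2 d < N.
Proof.
move=> /andP[d_gt0 ltd].
have ltN : logn 2 d < N by rewrite ltnNge -pfactor_dvdn // gtnNdvd.
by split=> //; have := minn_logn_mulD N c d_gt0; lia.
Qed.

Lemma logn2_odd d : odd d -> logn 2 d = 0.
Proof. by move=> odd_d; apply: logn_coprime; rewrite coprime2n. Qed.

Lemma logn2_expM N d : odd d -> logn 2 (2 ^ N * d) = N.
Proof.
move=> odd_d; have d_gt0 := odd_gt0 odd_d.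
by rewrite lognM ?expn_gt0 // pfactorK // logn2_odd // addn0.
Qed.

(** The successor avoids 0, where [logn] has the default value 0. *)
Definition ruler n := logn 2 n.+1.

(** Leaving [c] free at valuations from [N + 2] on lets this serve both the ruler and its capped
    versions. The position [i'] is congruent to [i] modulo [2 ^ N], which settles all valuations
    below [N]; at most one position of the window is left. *)
Lemma ruler_recurrence (c : nat -> nat) N k : k <= 2 ^ N ->
  (forall n, ruler n < N.+2 -> c n = ruler n) ->
  forall i j, exists i', [/\ j <= i', i' + k <= j + 2 ^ N.+3 &
    forall t, t < k -> odd (c (i' + t)) = odd (c (i + t))].
Proof.
move=> lek cE i j; have P_gt0 : 0 < 2 ^ N by rewrite expn_gt0.
have := divn_eq i (2 ^ N); have := ltn_pmod i P_gt0.
set q := i %/ _; set r := i %% _ => ltr eqi.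
have := divn_eq j (2 ^ N * 4).
have : j %% (2 ^ N * 4) < 2 ^ N * 4 by rewrite ltn_pmod //; lia.
set qj := j %/ _; set rj := j %% _ => ltrj eqj.
(* The exceptional position is [(q + 1) * 2 ^ N - 1]. Its counterpart in the new window gets
   valuation [N + s], of the required parity, since [4 * qj.+1 + s + 1] is odd for [s = 0] and twice
   an odd number for [s = 1]. *)
pose s := odd (c (q.+1 * 2 ^ N).-1) (+) odd N.
exists (r + 2 ^ N * (4 * qj.+1 + s)).
have le_s : 2 ^ N * s <= 2 ^ N by case: s; lia.
split; [lia | rewrite !expnS; lia | move=> t ltt].
have [eqP|neP] := eqVneq (r + t).+1 (2 ^ N).
  have -> : i + t = (q.+1 * 2 ^ N).-1 by lia.
  have rul : ruler (r + 2 ^ N * (4 * qj.+1 + s) + t) = N + s.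
    rewrite /ruler; case: (s).
      have -> : (r + 2 ^ N * (4 * qj.+1 + true) + t).+1
              = 2 ^ N.+1 * (2 * qj.+1).+1 by rewrite expnS; lia.
      by rewrite logn2_expM /=; lia.
    have -> : (r + 2 ^ N * (4 * qj.+1 + false) + t).+1
            = 2 ^ N * (4 * qj.+1).+1 by lia.
    by rewrite logn2_expM /=; lia.
  rewrite cE rul; last by case: (s); lia.
  by rewrite oddD oddb /s addbC addbK.
have rulE : forall a, ruler (a * 2 ^ N + (r + t)) = ruler (r + t) /\
    ruler (r + t) < N.
  move=> a; rewrite /ruler -addnS.
  have [lt|ge] := ltnP (r + t).+1 (2 ^ N); first exact: logn_lt_mulD.
  (* The window may run past one multiple of [2 ^ N]; [d] is the excess. *)
  have [d bd eqd] : exists2 d, 0 < d < 2 ^ N & (r + t).+1 = 1 * 2 ^ N + d.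
    by exists ((r + t).+1 - 2 ^ N); lia.
  have [l1 _] := logn_lt_mulD 1 bd; have [l2 lt2] := logn_lt_mulD a.+1 bd.
  have -> : a * 2 ^ N + (r + t).+1 = a.+1 * 2 ^ N + d by lia.
  by rewrite l2 eqd l1.
have -> : i + t = q * 2 ^ N + (r + t) by lia.
have -> : r + 2 ^ N * (4 * qj.+1 + s) + t
        = (4 * qj.+1 + s) * 2 ^ N + (r + t) by lia.
have [e1 lt1] := rulE q; have [e2 _] := rulE (4 * qj.+1 + s).
by rewrite !cE ?e1 ?e2 //; lia.
Qed.

(** * The ruler sequence, its capped versions and their regulators *)

Section Counterexample.
Variables (Sigma : finType) (a b : Sigma).

Definition ruler_seq (c : nat -> nat) n : Sigma := if odd (c n) then b else a.

Lemma ruler_seq_inj c m n : a != b ->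
  ruler_seq c m = ruler_seq c n -> odd (c m) = odd (c n).
Proof.
move=> neq_ab; rewrite /ruler_seq; case: (odd (c m)); case: (odd (c n)) => // /eqP.
  by rewrite eq_sym (negPf neq_ab).
by rewrite (negPf neq_ab).
Qed.

Lemma ruler_seq_recurrence c N :
  (forall n, ruler n < N.+2 -> c n = ruler n) ->
  forall i j, exists i', [/\ j <= i', i' + N <= j + 2 ^ N.+3 &
    block (ruler_seq c) i' N = block (ruler_seq c) i N].
Proof.
move=> cE i j.
have [i' [leji' le_end eqc]] := ruler_recurrence (ltnW (@ltn_expl 2 N isT)) cE i j.
exists i'; split=> //; apply: eq_block => t /eqc.
by rewrite /ruler_seq => ->.
Qed.

Lemma ruler_seq_eventually_sap : eventually_sap (ruler_seq ruler).
Proof.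
exists 0 => i n _; exists (2 ^ n.+3) => j.
rewrite !block_shift !add0n.
have [|i' [leji' le_end <-]] := @ruler_seq_recurrence ruler n _ i j.
  by [].
exact: infix_block.
Qed.

Definition ruler_regulator k := 2 ^ k.+3.

Lemma ruler_seq_regulator : regulator (ruler_seq ruler) ruler_regulator.
Proof.
move=> w; apply: (@regulator_at _ _ 0) => // i j _.
exact: ruler_seq_recurrence.
Qed.

(** The least cap that keeps all valuations below [N + 2], as [ruler_recurrence] demands at level
    [N]. *)
Definition capped_ruler N M n := if n < M then ruler n else minn (ruler n) N.+1.

Lemma capped_ruler_periodic N M n : M <= n ->
  capped_ruler N M (n + 2 ^ N.+1) = capped_ruler N M n.
Proof.
move=> leMn; rewrite /capped_ruler !ltnNge leMn (leq_trans leMn) ?leq_addr //=.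
by rewrite /ruler -addSn addnC -[X in X + _]mul1n minn_logn_mulD.
Qed.

Lemma capped_ruler_seq_periodic N M n : M <= n ->
  ruler_seq (capped_ruler N M) (n + 2 ^ N.+1) = ruler_seq (capped_ruler N M) n.
Proof. by move=> leMn; rewrite /ruler_seq capped_ruler_periodic. Qed.

Lemma capped_ruler_eventually_sap N M :
  eventually_sap (ruler_seq (capped_ruler N M)).
Proof.
exists M; apply: (@sap_periodic _ _ _ (2 ^ N.+1)); first by rewrite expn_gt0.
exact: capped_ruler_seq_periodic.
Qed.

(** Up to length [N] the old regulator is kept, for agreement with it; longer words get the bound
    coming from the period [2 ^ N.+1] after [M]. *)
Definition capped_regulator N M k :=
  if k <= N then ruler_regulator k else M + 2 ^ N.+1 + k.

Lemma capped_ruler_regulator N M :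
  regulator (ruler_seq (capped_ruler N M)) (capped_regulator N M).
Proof.
move=> w; rewrite /capped_regulator; case: leqP => [leN|_].
  (* For words of length at most [N] only valuations up to [N + 1] have to be intact. *)
  apply: (@regulator_at _ _ 0) => // i j _; apply: ruler_seq_recurrence => n.
  by rewrite /capped_ruler; case: ifP => // _; lia.
apply: (@regulator_at _ _ M) => //; first by rewrite -addnA leq_addr.
by apply: periodic_recurrence;
  [rewrite expn_gt0 | exact: capped_ruler_seq_periodic].
Qed.

Lemma capped_ruler_agree N M : N <= M ->
  agree_below N (ruler_seq ruler) ruler_regulator
    (ruler_seq (capped_ruler N M)) (capped_regulator N M).
Proof.
move=> leNM i ltiN; rewrite /ruler_seq /capped_ruler /capped_regulator.
by rewrite (leq_trans ltiN leNM) (ltnW ltiN).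
Qed.

Lemma capped_ruler_pr_gt N l : a != b -> exists2 M, N <= M &
  forall esap : eventually_sap (ruler_seq (capped_ruler N M)), l < pr esap.
Proof.
(* The valuations of [n + 1] and [n + 2 ^ N.+1 + 1] are [N.+1] and [N.+2]. *)
move=> neq_ab; pose n := (2 ^ N.+1 * (4 * l).+1).-1.
have P_gt0 : 0 < 2 ^ N.+1 by rewrite expn_gt0.
have n1 : n.+1 = 2 ^ N.+1 * (4 * l).+1 by rewrite prednK // muln_gt0 P_gt0.
have lt_ln : l <= n by rewrite -ltnS n1; nia.
(* Both [n] and [n + 2 ^ N.+1] lie below this [M], so neither value is capped. *)
exists (n + 2 ^ N.+1 + N).+1 => [|esap]; first by lia.
rewrite ltnNge; apply/negP => le_pr.
move: le_pr; rewrite /pr; case: ex_minnP => m /asboolP sap_m _ le_ml.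
(* As [m <= l <= n], the period would already hold at [n], forcing [N + 1] and [N + 2] to have the
   same parity. *)
have := sap_suffix_periodic (@capped_ruler_seq_periodic N _) sap_m
  (leq_trans le_ml lt_ln).
move=> /(ruler_seq_inj neq_ab); rewrite /capped_ruler !ifT; [|lia..].
rewrite /ruler -addSn n1 logn2_expM; last by rewrite /= oddM.
have -> : 2 ^ N.+1 * (4 * l).+1 + 2 ^ N.+1 = 2 ^ N.+2 * (2 * l).+1.
  by rewrite [2 ^ N.+2]expnS; lia.
by rewrite logn2_expM /= ?oddM //; case: (odd N).
Qed.

End Counterexample.

Theorem theorem6 (Sigma : finType) (card_Sigma : 1 < #|Sigma|) :
  ~ exists A : program 0,
      forall (omega : nat -> Sigma) (esap : eventually_sap omega)
             (f : nat -> nat),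
        regulator omega f ->
        exists l : nat, computes omega f A [tuple] l /\ pr esap <= l.
Proof.
move: (card_Sigma) => /card_gt1P[a [b [_ _ neq_ab]]] [A HA].
have [l [Al _]] := HA _ (ruler_seq_eventually_sap a b) _
  (ruler_seq_regulator a b).
have [N useN] := computes_finite_use Al.
(* The output [l] and the use [N] are fixed by the run on the ruler sequence, so [M] may depend on
   both. *)
have [M leNM /(_ (capped_ruler_eventually_sap a b N M))] :=
  capped_ruler_pr_gt N l neq_ab.
have [l' [Al' le_pr]] := HA _ (capped_ruler_eventually_sap a b N M) _
  (capped_ruler_regulator a b N M).
have eql := computes_inj (useN _ _ (capped_ruler_agree a b leNM)) Al'.
by rewrite ltnNge eql le_pr.
Qed.
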